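(* Let $K$ be a compact Hausdorff abelian topological group and let $H\leq K$ be a $\mathfrak{g}$-closed subgroup of $K$. Then $H$ (with the subspace topology) is realcompact.
   Context: $\mathbb{T}=\mathbb{R}/\mathbb{Z}$. For an abelian topological group $G$, $\hat G$ denotes its Pontryagin dual (the group of continuous homomorphisms $G\to\mathbb{T}$). For a sequence $\underline u=(u_n)$ in $\hat G$ put $s_{\underline u}(G)=\{x\in G\mid u_n(x)\longrightarrow 0 \text{ in } \mathbb{T}\}$. For a subgroup $H\leq G$ put $$\mathfrak{g}_G(H)=\bigcap\{s_{\underline u}(G)\mid \underline u\in \hat G^{\mathbb{N}},\ H\leq s_{\underline u}(G)\}.$$ $H$ is called $\mathfrak{g}$-closed in $G$ if $\mathfrak{g}_G(H)=H$. *)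

(* Defs.v *)
From HB Require Import structures.
From mathcomp Require Import all_boot all_order all_algebra ring_quotient.
From mathcomp Require Import all_classical all_reals all_analysis.

Set Implicit Arguments.
Unset Strict Implicit.
Unset Printing Implicit Defensive.

Import Order.TTheory GRing.Theory Num.Theory.
Import numFieldNormedType.Exports.

Local Open Scope classical_set_scope.
Local Open Scope ring_scope.
Local Open Scope quotient_scope.

Section Circle.
Variable R : realType.

Definition integers (x : R) : bool := x \is a Num.int.

Lemma integers_zmod_closed : zmod_closed integers.
Proof.
have [int1 intB _] := @int_num_subring R.
by split=> [|x y]; [rewrite -[0](subrr 1); exact: intB | exact: intB].
Qed.

HB.instance Definition _ := GRing.isZmodClosed.Build R integers
  integers_zmod_closed.

Definition R_mod_Z : Type :=
  Quotient.quot (GRing.ZmodClosed.clone R integers _).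

HB.instance Definition _ := ZmodQuotient.on R_mod_Z.

Definition circle : Type := quotient_topology R_mod_Z.

HB.instance Definition _ := Topological.on circle.
HB.instance Definition _ := GRing.isZmodule.Build circle
  (@addrA R_mod_Z) (@addrC R_mod_Z) (@add0r R_mod_Z) (@addNr R_mod_Z).

Definition circle_pi (x : R) : circle := \pi_R_mod_Z x.

Lemma circle_piB x y : circle_pi (x - y) = circle_pi x - circle_pi y.
Proof. exact: (raddfB (\pi_R_mod_Z)). Qed.

Lemma circle_pi_surj (a : circle) : exists x, circle_pi x = a.
Proof. by exists (repr (a : R_mod_Z)); exact: reprK. Qed.

Lemma circle_pi_eq0 x : circle_pi x = 0 <-> x \is a Num.int.
Proof.
have pi0 : circle_pi 0 = 0.
  by rewrite -[X in circle_pi X](subrr 0) circle_piB subrr.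
pose S : zmodClosed R := GRing.ZmodClosed.clone R integers _.
rewrite -pi0 -[X in X \is a _]subr0; split => [|xZ].
  by move/(congr1 (fun a : Quotient.quot S => a)) => /eqP; rewrite -Quotient.idealrBE.
by apply/(@eqP (Quotient.quot S)); rewrite -Quotient.idealrBE.
Qed.

Lemma circle_openE (U : set circle) : open U = open (circle_pi @^-1` U).
Proof. by []. Qed.

Lemma circle_pi_continuous : continuous circle_pi.
Proof. exact: pi_continuous. Qed.

Lemma circle_pi_open (U : set R) : open U -> open (circle_pi @` U).
Proof.
move=> oU; rewrite circle_openE.
have -> : circle_pi @^-1` (circle_pi @` U) =
    \bigcup_(z in [set z | z \is a Num.int]) ((fun x => x + z) @^-1` U).
  apply/seteqP; split => [x [y Uy xy]|x [z zZ Uxz]].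
    exists (y - x); last by rewrite /= addrC subrK.
    by apply/circle_pi_eq0; rewrite circle_piB xy subrr.
  exists (x + z) => //; apply: subr0_eq; rewrite -circle_piB addrC addKr.
  exact/circle_pi_eq0.
apply: bigcup_open => z _; apply: open_comp => // x _.
by apply: cvgD; [exact: cvg_id | exact: cvg_cst].
Qed.

Lemma circle_sub_continuous : continuous (fun x : circle * circle => x.1 - x.2).
Proof.
move=> [a b]; have [x <-] := circle_pi_surj a; have [y <-] := circle_pi_surj b.
move=> W /=; rewrite -circle_piB => /circle_pi_continuous nW.
have /= [[U V] /= [nU nV] sUV] := @sub_continuous R (x, y) _ nW.
have im z (A : set R) : nbhs z A -> nbhs (circle_pi z) (circle_pi @` A).
  rewrite nbhsE => -[B [oB Bz] BA].
  apply: (@filterS _ _ _ (circle_pi @` B)); first exact: image_subset.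
  by apply: open_nbhs_nbhs; split; [exact: circle_pi_open | exists z].
exists (circle_pi @` U, circle_pi @` V); first by split; exact: im.
move=> [_ _] [/= [u Uu <-] [v Vv <-]]; rewrite -circle_piB.
exact: (sUV (u, v)).
Qed.

HB.instance Definition _ :=
  PreTopologicalNmodule_isTopologicalZmodule.Build circle circle_sub_continuous.

End Circle.

Section GClosure.
Variables (R : realType) (G : topologicalZmodType).

Definition dual : set (G -> circle R) :=
  [set chi | zmod_morphism chi /\ continuous chi].

Definition s_ (u : nat -> G -> circle R) : set G :=
  [set x | u n x @[n --> \oo] --> (0 : circle R)].

Definition g_closure (H : set G) : set G :=
  \bigcap_(u in [set u : nat -> G -> circle R |
                  (forall n, dual (u n)) /\ H `<=` s_ u]) s_ u.

Definition g_closed (H : set G) : Prop := g_closure H = H.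

End GClosure.

Definition homeomorphic (X Y : topologicalType) : Prop :=
  exists (f : X -> Y) (g : Y -> X),
    [/\ cancel f g, cancel g f, continuous f & continuous g].

(* A set [A] coerces to the type of its elements, which carries the subspace
   topology; [{ptws I -> R}] is the power of [R] with the product topology. *)
Definition realcompact (R : realType) (X : topologicalType) : Prop :=
  exists (I : Type) (A : set {ptws I -> R}), closed A /\ homeomorphic X A.

(* Main.v *)
(* If x is not in H, some sequence (u_n) of characters tends to 0 on H but not
   at x.  With rho >= 0 continuous on the circle and vanishing only at 0, the
   function g(y) = sum_n 2^-n rho(u_n(y - x)) is continuous on K, vanishes at x,
   and has no zero on H: a zero y satisfies u_n(y) = u_n(x) for all n.  Hence
   every point of K outside H is a zero of a continuous function which is
   invertible on H.  Embed H into a power of the reals by all its continuous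
   functions; if these converge along a filter on H, the filter clusters at
   some x in K by compactness, and x lies in H because g and 1/g cannot both
   converge when g tends to 0.  So the image is closed. *)
Require Import Defs.
From mathcomp Require Import all_boot all_order all_algebra.
From mathcomp Require Import all_classical all_reals all_analysis.
From mathcomp Require Import lra.
Import numFieldNormedType.Exports.
Import Order.TTheory GRing.Theory Num.Theory.
Local Open Scope classical_set_scope.
Local Open Scope ring_scope.

Section Realcompactness.
Context {R : realType} {X : topologicalType}.

Let C := set_type [set f : X -> R | continuous f].
Let ev (f : C) : X -> R := set_val f.

Let ev_continuous (f : C) : continuous (ev f).
Proof. exact: set_mem (valP f). Qed.

(** The two separation hypotheses make evaluation at all continuous functions an embedding into a
    power of [R]; the hypothesis on filters makes its range closed. *)
Lemma realcompact_cluster :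
  accessible_space X -> completely_regular_space X ->
  (forall F : set_system X, ProperFilter F ->
     (forall f : X -> R, continuous f -> cvg (f @ F)) -> cluster F !=set0) ->
  realcompact R X.
Proof.
move=> T1 crX clX.
have sepf : separate_points_from_closed ev.
  move=> B x clB nBx.
  have usep := crX _ _ clB nBx.
  pose f : X -> R := Urysohn [set x] B.
  have cf : f \in [set f : X -> R | continuous f].
    by apply: mem_set; exact: Urysohn_continuous.
  have f1 : f @` B `<=` [set 1] by exact: Urysohn_sub1.
  have f0 : f x = 0 by apply: (Urysohn_sub0 usep); exists x.
  exists (exist _ f cf); rewrite /ev /= => clf.
  have : closure [set 1 : R] (f x) by exact: (closure_subset f1).
  have /closure_id <- : closed [set (1 : R)].
    by apply/accessible_closed_set1/hausdorff_accessible/Rhausdorff.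
  by rewrite f0 /= => /esym/eqP; rewrite oner_eq0.
pose e : X -> {ptws C -> R} := join_product ev.
have e_cont : continuous e.
  by apply: join_product_continuous => // f; exact: ev_continuous.
have e_inj x y : e x = e y -> x = y.
  by apply: (join_product_inj sepf T1); rewrite inE.
exists C, (range e); split.
  move=> a cla.
  (* [F] is the trace on [X] of the neighbourhoods of [a], proper because [a] is adherent to the
     range. Along it each coordinate [ev f] tends to [a f], so a cluster point of [F] must be sent
     to [a]. *)
  pose F := filter_from (nbhs a) (fun V => e @^-1` V).
  have FF : ProperFilter F.
    apply: filter_from_proper; last first.
      by move=> V /cla [_ [[x _ <-] Vx]]; exists x.
    apply: filter_from_filter; first by exists setT; exact: filterT.
    by move=> V W nV nW; exists (V `&` W) => //; exact: filterI.
  have Fcvg (f : C) : ev f @ F --> a f.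
    move=> V nV; exists (proj f @^-1` V) => //.
    exact: (@proj_continuous C (fun=> R) f a).
  have [x clx] : cluster F !=set0.
    apply: clX => f cf; apply/cvg_ex.
    by have := Fcvg (exist _ f (mem_set cf)); eexists; eassumption.
  exists x => //; apply/funext => f.
  apply: (@Rhausdorff R) => U V nU /Fcvg nV.
  have [y [Vy Uy]] := clx _ _ nV (ev_continuous f x _ nU).
  by exists (ev f y).
have im x : e x \in range e by apply: mem_set; exists x.
have preim (a : range e) : {x | e x = set_val a}.
  by apply: cid; have /set_mem [x _ xa] := valP a; exists x.
exists (fun x => exist _ (e x) (im x)), (fun a => sval (preim a)); split.
- by move=> x; apply: e_inj; rewrite (svalP (preim _)).
- by move=> a; apply: val_inj; rewrite /= (svalP (preim _)).
- apply: continuous_comp_initial; exact: e_cont.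
- apply/continuousP => U oU.
  (* [e] is open onto its range, so the preimage of [U] under the inverse map is the trace of some
     open [V]. *)
  have /open_subspaceP [V oV VU] := join_product_open sepf oU.
  exists V => //; apply/seteqP; split => a /= Ha.
    have : (join_product ev @` U `&` range e) (set_val a).
      by rewrite -VU; split => //; exact: set_mem (valP a).
    by move=> [[x Ux xa] _]; rewrite (e_inj (sval (preim a)) x) // (svalP (preim a)).
  have : (V `&` range e) (set_val a); last by case.
  rewrite VU; split; last exact: set_mem (valP a).
  by exists (sval (preim a)) => //; exact: (svalP (preim a)).
Qed.

End Realcompactness.

(** The function is the series of the [f k / 2 ^+ k], obtained as the supremum of its increasing
    partial sums. It converges uniformly, hence is continuous, and a sum of nonnegative terms
    vanishes only when every term does. *)
Lemma continuous_zeros_bigcap (R : realType) (T : topologicalType)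
    (f : nat -> T -> R) :
  (forall n, continuous (f n)) -> (forall n x, 0 <= f n x <= 1) ->
  exists2 g : T -> R, continuous g &
    forall x, g x = 0 <-> forall n, f n x = 0.
Proof.
move=> cf f01.
pose S n x := \sum_(k < n) f k x / 2 ^+ k.
pose g x := sup (range (S^~ x)).
(* The term [2 / 2 ^+ n] is the geometric tail from index [n]. Since [f n <= 1], adding this tail
   turns the increasing [S n] into a decreasing sequence, so each corrected sum bounds all partial
   sums. *)
have S_le m n x : (S m x <= S n x + 2 / 2 ^+ n).
  have homoS : {homo S^~ x : i j / (i <= j)%N >-> i <= j}.
    apply/nondecreasing_seqP => k; rewrite /S big_ord_recr /= lerDl.
    by rewrite divr_ge0 ?exprn_ge0 //; case/andP: (f01 k x).
  have homoU : {homo (fun n => S n x + 2 / 2 ^+ n) :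
      i j / (i <= j)%N >-> j <= i}.
    apply/nonincreasing_seqP => k; rewrite /S big_ord_recr /= -addrA lerD2l.
    have /andP[_ f1] := f01 k x.
    have p : (0 : R) < 2 ^+ k by rewrite exprn_gt0.
    rewrite exprS invfM mulrA divff ?pnatr_eq0 // -mulrDl ler_pM2r ?invr_gt0 //.
    lra.
  have U_ge k : S k x <= S k x + 2 / 2 ^+ k.
    by rewrite lerDl divr_ge0 ?exprn_ge0.
  have [mn|/ltnW nm] := leqP m n.
    exact: le_trans (homoS _ _ mn) (U_ge n).
  exact: le_trans (U_ge m) (homoU _ _ nm).
have S_le_g n x : S n x <= g x.
  apply: ub_le_sup; last by exists n.
  by exists (S 0%N x + 2 / 2 ^+ 0) => _ [m _ <-].
have g_le n x : g x <= S n x + 2 / 2 ^+ n.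
  by apply: ge_sup; [exists (S 0%N x); exists 0%N | move=> _ [m _ <-]].
have cS n : continuous (S n).
  elim: n => [|n IHn] x.
    have -> : S 0%N = cst 0 by apply/funext => y; rewrite /S big_ord0.
    exact: cvg_cst.
  have -> : S n.+1 = (fun y => S n y + f n y / 2 ^+ n).
    by apply/funext => y; rewrite /S big_ord_recr.
  by apply: cvgD; [exact: IHn | apply: cvgMl; exact: cf].
exists g.
  move=> x; apply/cvgrPdist_lt => e e0.
  have [n ne] : exists n, 2 / 2 ^+ n < e / 2 :> R.
    have half1 : `|1 / 2| < 1 :> R by rewrite ger0_norm; lra.
    have [N _ HN] := (cvgrPdist_lt _ _).1
      (@cvg_geometric R 2 (1 / 2) half1) _ (divr_gt0 e0 (ltr0Sn R 1)).
    exists N; have /= := HN N (leqnn N); rewrite sub0r normrN.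
    by apply: le_lt_trans; rewrite div1r exprVn ler_norm.
  have : \forall y \near x, `|S n x - S n y| < e / 2.
    by move/cvgrPdist_lt: (cS n x); apply; rewrite divr_gt0.
  apply: filterS => y; rewrite !ltr_norml.
  (* Both values of [g] exceed those of [S n] by at most [2 / 2 ^+ n < e / 2], and the values of
     [S n] differ by less than [e / 2]. *)
  move: (S_le_g n x) (S_le_g n y) (g_le n x) (g_le n y); lra.
move=> x; split => [gx0 n|fx0].
  have f0 k : 0 <= f k x / 2 ^+ k.
    by rewrite divr_ge0 ?exprn_ge0 //; case/andP: (f01 k x).
  have /eqP : S n.+1 x = 0.
    by apply/eqP; rewrite eq_le sumr_ge0 // andbT -gx0.
  rewrite /S psumr_eq0 // => /allP /(_ ord_max (mem_index_enum _)) /=.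
  by rewrite mulf_eq0 invr_eq0 expf_eq0 pnatr_eq0 andbF orbF => /eqP.
have -> : g x = sup [set 0]; last by rewrite sup1.
congr sup; apply/seteqP; split => y /=.
  by move=> [n _ <-]; apply: big1 => k _; rewrite fx0 mul0r.
by move=> ->; exists 0%N => //; rewrite /S big_ord0.
Qed.

(** The square of [sin (pi * x)] has period 1 and vanishes exactly at the integers, so it descends
    to the circle. *)
Lemma circle_separating_function (R : realType) :
  exists rho : circle R -> R, [/\ continuous rho, forall a, 0 <= rho a <= 1 &
    forall a, rho a = 0 <-> a = 0].
Proof.
pose s (x : R) := sin (pi * x) ^+ 2.
pose rho (a : circle R) := s (sval (cid (circle_pi_surj a))).
have sZ x y : x - y \is a Num.int -> s x = s y.
  have sN z n : s (z + n%:R) = s z.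
    rewrite /s mulrDr mulr_natr (alternatingn (@sinDpi R)) exprMn.
    by rewrite sqrr_sign mul1r.
  move=> /intrP[[n|n] Exy]; first by rewrite -(subrK y x) Exy addrC sN.
  rewrite -(sN x n.+1); congr s; apply/eqP; rewrite -subr_eq0 addrAC Exy.
  by rewrite NegzE mulrNz addNr.
have rho_pi x : rho (circle_pi x) = s x.
  rewrite /rho; case: cid => y /= Ey; apply/sZ/circle_pi_eq0.
  by rewrite circle_piB Ey subrr.
exists rho; split.
(* By the quotient topology it suffices that [s], the lift of [rho] to [R], is continuous. *)
- apply/continuousP => U oU; rewrite circle_openE.
  have -> : @circle_pi R @^-1` (rho @^-1` U) = s @^-1` U.
    by apply/seteqP; split => x /=; rewrite rho_pi.
  apply: open_comp => // x _.
  have cs : {for x, continuous (fun y : R => sin (pi * y))}.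
    apply: continuous_comp; last exact: continuous_sin.
    by apply: cvgMr; exact: cvg_id.
  by rewrite /s; under eq_fun do rewrite expr2; apply: cvgM.
- move=> a; rewrite /rho /s sqr_ge0 sin2cos2 gerBl; exact: sqr_ge0.
- move=> a; have [x <-] := circle_pi_surj a.
  rewrite rho_pi circle_pi_eq0; split.
    (* The fractional part [z] lies in [[0, 1)], where [sin (pi * z)] is positive unless [z = 0]. *)
    pose z := x - (Num.floor x)%:~R.
    have /andP[z_ge0 z_lt1] : 0 <= z < 1.
      by rewrite subr_ge0 ltrBlDl -intrD1 floor_itv.
    rewrite (sZ x z) ?opprB 1?addrC ?subrK ?intr_int // => /eqP.
    rewrite sqrf_eq0 => /eqP sz.
    have [z0|z_neq0] := eqVneq z 0.
      by rewrite intrEfloor eq_sym -subr_eq0; apply/eqP.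
    have : 0 < sin (pi * z).
      apply: sin_gt0_pi.
      by rewrite gtr_pMr ?pi_gt0 // z_lt1 mulr_gt0 ?pi_gt0 // lt0r z_neq0.
    by rewrite sz ltxx.
  by move=> xZ; rewrite (@sZ x 0) ?subr0 // /s mulr0 sin0 expr0n.
Qed.

(** The topological half of the argument: the last hypothesis presents [H] as an intersection of
    cozero sets of [K]. *)
Lemma realcompact_zeros (R : realType) (K : topologicalType) (H : set K) :
  compact [set: K] -> hausdorff_space K ->
  (forall x, ~ H x -> exists g : K -> R,
     [/\ continuous g, g x = 0 & forall y, H y -> g y <> 0]) ->
  realcompact R H.
Proof.
move=> cK hK sep.
have crK : completely_regular_space K.
  apply: (@normal_completely_regular R); first exact: compact_normal.
  exact: hausdorff_accessible.
have val_cont : continuous (set_val : H -> K) by exact: initial_continuous.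
apply: realcompact_cluster.
- apply: hausdorff_accessible => x y clxy; apply: val_inj.
  apply: hK => U V nU nV.
  have [z [Uz Vz]] := clxy _ _ (val_cont x _ nU) (val_cont y _ nV).
  by exists (set_val z).
- move=> x B clB nBx.
  (* Complete regularity passes to [H]: separate [x] in [K] from the complement of an open [V] whose
     trace misses [B], then restrict. *)
  have : nbhs x (~` B) by apply: open_nbhs_nbhs; split; rewrite ?openC.
  move=> -[_ [[V oV <-] Vx VB]].
  have nVx : ~ (~` V) (set_val x) by apply; exact: Vx.
  have /(@uniform_separatorP _ R) [f [cf fI f0 f1]] :=
    crK _ _ (open_closedC oV) nVx.
  apply/(@uniform_separatorP _ R); exists (f \o set_val); split.
  + by move=> y; apply: continuous_comp; [exact: val_cont | exact: cf].
  + by move=> _ [y _ <-]; apply: fI; exists (set_val y).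
  + by move=> _ [_ -> <-]; apply: f0; exists (set_val x).
  + move=> _ [y By <-]; apply: f1; exists (set_val y) => // Vy.
    exact: (VB y).
move=> F FF Fcvg.
have [x [_ clx]] := cK (set_val @ F) _ (@filterT _ _ _).
have cont_g (g : K -> R) : continuous g -> g \o set_val @ F --> g x.
  move=> cg.
  have /cvg_ex[l Fl] : cvg (g \o set_val @ F).
    by apply: Fcvg => y; apply: continuous_comp; [exact: val_cont | exact: cg].
  suff -> : g x = l by [].
  apply: (@Rhausdorff R) => U V nU nV.
  have [z [Vz Uz]] := clx (g @^-1` V) (g @^-1` U) (Fl _ nV) (cg x _ nU).
  by exists (g z).
have [Hx|/sep[g [cg gx0 gN0]]] := pselect (H x).
  (* Neighbourhoods in [H] are traces of those in [K], so a cluster point in [K] that lies in [H] is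
     one for [F] itself. *)
  exists (exist _ x (mem_set Hx)) => A B FA [_ [[V oV <-] Vx VB]].
  have FA' : F (set_val @^-1` (set_val @` A)).
    exact: filterS (@preimage_image _ _ _ _) FA.
  have [_ [[z Az <-] Vz]] := clx _ V FA' (open_nbhs_nbhs (conj oV Vx)).
  by exists z; split => //; exact: VB.
have gN (y : H) : g (set_val y) != 0.
  by apply/eqP/gN0; exact: set_mem (valP y).
have cgH : continuous (g \o set_val : H -> R).
  by move=> y; apply: continuous_comp; [exact: val_cont | exact: cg].
have /cvg_ex[l Fl] : cvg ((fun y => (g (set_val y))^-1) @ F).
  apply: Fcvg => y.
  by apply: (@cvgV _ _ (nbhs y) _ (g \o set_val)); [exact: gN | exact: cgH].
have : (fun y => g (set_val y) * (g (set_val y))^-1) @ F --> g x * l.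
  by apply: cvgM => //; exact: cont_g.
rewrite gx0 mul0r (_ : (fun y => _) = cst 1); last first.
  by apply/funext => y; rewrite divff.
move=> /(cvg_unique (@Rhausdorff R) (cvg_cst (1 : R))) /eqP.
by rewrite oner_eq0.
Qed.

Lemma not_null_zero_function (R : realType) (K : topologicalZmodType)
    (u : nat -> K -> circle R) (x : K) :
  (forall n, dual (u n)) -> ~ s_ u x ->
  exists g : K -> R, [/\ continuous g, g x = 0 & forall y, s_ u y -> g y <> 0].
Proof.
move=> du nux.
have [rho [crho rho01 rho0]] := circle_separating_function R.
have [|n y|g cg g0] :=
  @continuous_zeros_bigcap R K (fun n y => rho (u n (y - x))).
- move=> n y; apply: continuous_comp; last exact: crho.
  apply: continuous_comp; last exact: (du n).2.
  have sub_cont : {for (y, x), continuous (fun p : K * K => p.1 - p.2)}.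
    exact: sub_continuous.
  apply: (@cvg_comp _ _ _ (fun z => (z, x)) (fun p : K * K => p.1 - p.2));
    last exact: sub_cont.
  by apply: cvg_pair; [exact: cvg_id | exact: cvg_cst].
- exact: rho01.
exists g; split => // [|y uy].
  (* Characters are given as preserving differences, so [0] is written as [0 - 0] to see that it is
     sent to [0]. *)
  by apply/g0 => n; apply/rho0; rewrite subrr -(subrr (0 : K)) (du n).1 subrr.
move/g0 => gy0; apply: nux; rewrite /s_ /=.
(* If [g y = 0], the characters do not distinguish [y] from [x], and convergence at [y] would carry
   over to [x]. *)
have -> : (fun n => u n x) = (fun n => u n y).
  apply/funext => n; apply/esym/subr0_eq; rewrite -(du n).1.
  exact/rho0/gy0.
exact: uy.
Qed.

Theorem theorem1p3 (R : realType) (K : topologicalZmodType)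
    (K_compact : compact [set: K]) (K_hausdorff : hausdorff_space K)
    (H : set K) (H_subgroup : zmod_closed [in H]) (H_closed : g_closed R H) :
  realcompact R H.
Proof.
apply: realcompact_zeros => // x; rewrite -{1}H_closed.
move=> /existsNP[u /not_implyP[[du Hu] nux]].
have [g [cg gx0 gN0]] := not_null_zero_function _ _ _ _ du nux.
by exists g; split => // y /Hu /gN0.
Qed.
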